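(* Let $n, d \ge 1$ and let $p$ be a real stable homogeneous polynomial of degree $d$ in $n$ variables with non-negative real coefficients, such that $p(\mathbf{1}) = 1$ and $\nabla p(\mathbf{1}) = \alpha$. For any $y \in \mathbb{R}^n$ in the positive orthant, there exists a product of linear forms $f(x) := \prod_{i=1}^d \sum_{j=1}^n a_{ij} x_j$ with all $a_{ij} \geq 0$ such that $f(\mathbf{1}) = 1$, $\nabla f(\mathbf{1}) = \alpha$, and $p(y) = f(y)$.
   Context: $\mathbf{1}$ denotes the all-ones vector in $\mathbb{R}^n$. A polynomial $p$ with non-negative real coefficients is real stable if $p(x_1,\ldots,x_n) \neq 0$ whenever $x_1,\ldots,x_n$ all lie in the open complex upper half-plane. *)

(* Defs.v *)
From HB Require Import structures.
From mathcomp Require Import all_boot all_order all_algebra.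
From mathcomp Require Import reals complex mpoly.

Set Implicit Arguments.
Unset Strict Implicit.
Unset Printing Implicit Defensive.

Import Order.TTheory GRing.Theory Num.Theory.

Local Open Scope ring_scope.

Definition nonneg_coeffs (R : realType) (n : nat) (p : {mpoly R[n]}) : Prop :=
  forall m : 'X_{1..n}, 0 <= p@_m.

Definition real_stable (R : realType) (n : nat) (p : {mpoly R[n]}) : Prop :=
  forall z : 'I_n -> R[i],
    (forall j, 0 < complex.Im (z j)) ->
    (map_mpoly (real_complex R) p).@[z] != 0.

Definition all_ones (R : realType) (n : nat) : 'I_n -> R := fun=> 1.

Definition gradient (R : realType) (n : nat) (p : {mpoly R[n]})
    (x : 'I_n -> R) : 'rV[R]_n :=
  \row_(j < n) (p^`M(j)).@[x].

Definition prod_linear_forms (R : realType) (d n : nat) (a : 'M[R]_(d, n)) :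
    {mpoly R[n]} :=
  \prod_(i < d) \sum_(j < n) a i j *: 'X_j.

(* Main.v *)
(** The univariate polynomial P(t) = p(y + t 1) is monic with real roots x_i, and
    Q_j(t) = (d_j p)(y + t 1) satisfies Im (Q_j / P) <= 0 on the upper half-plane:
    F(s) = p(y + t 1 + s e_j) has all its roots in the lower half-plane, and
    Q_j(t) / P(t) = F'(0) / F(0).  Hence the poles of Q_j / P are simple with
    nonnegative residues; a_ij is the residue at x_i divided by the multiplicity of
    x_i (when the roots are simple, the partial derivative of the eigenvalue - x_i
    in the direction e_j).  The identity sum_j Q_j = P' gives row sums 1, Euler's
    identity sum_j (y_j + t) Q_j = d P gives a y = - x, whence
    prod_i (a y)_i = P(0) = p(y), and comparing top coefficients in the partial
    fraction expansion of Q_j / P gives column sums alpha. *)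
Require Import Defs.
From HB Require Import structures.
From mathcomp Require Import all_boot all_order all_algebra.
From mathcomp Require Import reals complex mpoly polyrcf.
From mathcomp Require Import ring lra zify.

Set Implicit Arguments.
Unset Strict Implicit.
Unset Printing Implicit Defensive.

Import Order.TTheory GRing.Theory Num.Theory.

Local Open Scope ring_scope.

(** * Imaginary parts of univariate polynomials and signs of residues *)

Lemma horner_le0_at0 (R : rcfType) (h : {poly R}) :
  (forall e, 0 < e -> h.[e] <= 0) -> h.[0] <= 0.
Proof.
move=> h_le0; rewrite leNgt; apply/negP => h0_gt0.
have [e e_gt0 /(_ (e / 2))] := poly_cont 0 h h0_gt0.
rewrite subr0 gtr0_norm ?divr_gt0 // => /(_ _)/wrap[|]; first by lra.
have := h_le0 (e / 2); rewrite divr_gt0 // => /(_ isT) he.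
rewrite ler0_norm; lra.
Qed.

(** At real points, [complex.Im] of [S] is the real polynomial whose coefficients are the imaginary
    parts of those of [S], so continuity of real polynomials applies. *)
Lemma Im_horner_le0_at0 (R : rcfType) (S : {poly R[i]}) :
  (forall e, 0 < e -> complex.Im S.[real_complex R e] <= 0) ->
  complex.Im S.[0] <= 0.
Proof.
move=> S_le0.
pose h := \poly_(k < size S) complex.Im S`_k.
have hE e : h.[e] = complex.Im S.[real_complex R e].
  rewrite horner_poly horner_coef (big_morph (@complex.Im R) (id1 := 0) (op1 := +%R)) //.
    apply: eq_bigr => k _; rewrite -rmorphXn /=; case: (S`_k) => a b /=; ring.
  by case=> [a b] [c e'].
have := @horner_le0_at0 _ h; rewrite hE; apply => e e_gt0.
by rewrite hE S_le0.
Qed.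

(** The roots of ['X^k - i c] sum to zero, since for [1 < k] the coefficient of degree [k.-1]
    vanishes. None of them is real, so they cannot all lie in the lower half-plane. *)
Lemma exp_eq_imaginary (R : rcfType) (k : nat) (c : R) : (1 < k)%N -> c != 0 ->
  exists w : R[i], 0 < complex.Im w /\ w ^+ k = Complex 0 c.
Proof.
move=> k_gt1 c_neq0.
pose q : {poly R[i]} := 'X^k - (Complex 0 c)%:P.
have k_gt0 : (0 < k)%N by apply: ltnW.
have size_q : size q = k.+1 by rewrite size_XnsubC.
have [s qE] := closed_field_poly_normal q.
have lq : lead_coef q = 1 by apply: lead_coefXnsubC.
rewrite lq scale1r in qE.
have size_s : size s = k.
  by have := size_q; rewrite qE size_prod_XsubC => -[].
have root_s w : w \in s -> w ^+ k = Complex 0 c.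
  by rewrite -root_prod_XsubC -qE /root /q !hornerE subr_eq0 => /eqP.
have Im_s w : w \in s -> complex.Im w != 0.
  move=> /root_s; case: w => a b; apply: contra_eqN => /= /eqP ->.
  by rewrite complexr0 -rmorphXn /= eq_complex /= negb_and (eq_sym 0 c) c_neq0 orbT.
have sum_s : \sum_(w <- s) w = 0.
  have := coefPn_prod_XsubC (ps := s); rewrite size_s -lt0n => /(_ k_gt0).
  rewrite -qE coefB coefXn coefC.
  have -> : (k.-1 == k) = false by apply/negP; lia.
  have -> : (k.-1 == 0%N) = false by apply/negP; lia.
  by rewrite subr0 => /eqP; rewrite eq_sym oppr_eq0 => /eqP.
have [/hasP[w ws Im_w] | /hasPn Im_le0] :=
  boolP (has (fun w : R[i] => 0 < complex.Im w) s); first by exists w; split; auto.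
have : \sum_(w <- s) complex.Im w < 0.
  case: s {qE root_s} size_s Im_s Im_le0 sum_s => [|w s] size_s Im_s Im_le0 _.
    by rewrite -size_s in k_gt0.
  have neg z : z \in w :: s -> complex.Im z < 0.
    by move=> zs; rewrite lt_neqAle Im_s //= leNgt Im_le0.
  rewrite big_cons; apply: ltr_wnDr; last by apply: neg; rewrite inE eqxx.
  rewrite big_seq; apply: sumr_le0 => z zs; apply/ltW/neg.
  by rewrite inE zs orbT.
have <- : complex.Im (\sum_(w <- s) w) = \sum_(w <- s) complex.Im w.
  by apply: (big_morph (@complex.Im R)) => // -[a b] [a' b'].
by rewrite sum_s ltxx.
Qed.

(** The quantity is |F(0)|^2 times the imaginary part of F'(0)/F(0). That quotient is the sum of
    -1/z over the roots z, and each Im(-1/z) = Im z / |z|^2 is negative. *)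
Lemma Im_deriv_mul_conj_le0 (R : rcfType) (F : {poly R[i]}) :
  (forall s, 0 <= complex.Im s -> F.[s] != 0) ->
  complex.Im (F^`().[0] * conjc F.[0]) <= 0.
Proof.
have [rs ->] := closed_field_poly_normal F.
set c := lead_coef F.
elim: rs => [|z rs IH] F_neq0.
  by rewrite big_nil derivZ -polyC1 derivC scaler0 horner0 mul0r.
have Im_z : complex.Im z < 0.
  rewrite ltNge; apply/negP => /F_neq0.
  by rewrite big_cons scalerAr hornerM hornerXsubC subrr mul0r eqxx.
have {}IH := IH _; move: F_neq0; rewrite big_cons scalerAr.
set G := c *: _ in IH * => F_neq0.
have {IH}/IH : forall s, 0 <= complex.Im s -> G.[s] != 0.
  by move=> s /F_neq0; rewrite hornerM mulf_eq0 negb_or => /andP[].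
rewrite derivM derivXsubC mul1r hornerD !hornerM hornerXsubC sub0r.
case: (G.[0]) (G^`().[0]) z Im_z {F_neq0} => [a b] [a' b'] [u v] /= v_lt0 le0.
(* For F = (X - z) G the imaginary part is |z|^2 Im(G'(0) conj G(0)) + |G(0)|^2 Im z, a sum of two
   nonpositive terms. *)
have := mulr_ge0_le0 (addr_ge0 (sqr_ge0 u) (sqr_ge0 v)) le0.
have := mulr_ge0_le0 (addr_ge0 (sqr_ge0 a) (sqr_ge0 b)) (ltW v_lt0).
nra.
Qed.

Lemma Im_real_mul (R : rcfType) (r : R) (z : R[i]) :
  complex.Im (real_complex R r * z) = r * complex.Im z.
Proof. by case: z => a b /=; rewrite mul0r addr0. Qed.

(** Approach [x] along t = x + e w with e > 0. The product in the hypothesis becomes |w|^(2m)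
    e^(2m+k) times conj(w)^k U(t) conj(V(t)); drop the positive real factor and let e tend to 0. *)
Lemma residue_direction_le0 (R : rcfType) (U V : {poly R}) (x : R) (m k : nat) (w : R[i]) :
  (forall t : R[i], 0 < complex.Im t ->
     complex.Im ((map_poly (real_complex R) (U * ('X - x%:P) ^+ m)).[t] *
       conjc (map_poly (real_complex R) (V * ('X - x%:P) ^+ (m + k))).[t]) <= 0) ->
  0 < complex.Im w ->
  U.[x] * V.[x] * complex.Im (conjc w ^+ k) <= 0.
Proof.
move=> le0 Im_w.
pose f := real_complex R.
pose L : {poly R[i]} := w *: 'X + (f x)%:P.
(* Conjugating the coefficients makes the expression a polynomial in e: at real e it agrees with the
   conjugate of the value. *)
pose S := (conjc w ^+ k) *:
  ((map_poly f U \Po L) * map_poly (@conjc R) (map_poly f V \Po L)).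
have SE e : S.[f e] = conjc w ^+ k * ((map_poly f U).[w * f e + f x] *
                        conjc (map_poly f V).[w * f e + f x]).
  rewrite /S hornerZ hornerM !horner_comp.
  have -> : (map_poly (@conjc R) (map_poly f V \Po L)).[f e] =
            conjc (map_poly f V \Po L).[f e].
    by rewrite -{1}(conjc_real e : conjc (f e) = f e) horner_map.
  by rewrite horner_comp !hornerE.
have := @Im_horner_le0_at0 R S.
have := SE 0; rewrite [f 0]rmorph0 mulr0 add0r !horner_map conjc_real => ->.
rewrite mulrC -(rmorphM f) Im_real_mul; apply => e e_gt0.
rewrite SE; set t := _ + f x.
have Im_t : 0 < complex.Im t.
  rewrite /t /f; case: (w) Im_w => a b /= b_gt0.
  by rewrite mulr0 add0r addr0 mulr_gt0.
have tx : t - f x = w * f e by rewrite /t addrK.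
have := le0 t Im_t.
rewrite !rmorphM !rmorphXn /= !rmorphB /= !map_polyX !map_polyC /=.
rewrite !hornerM !horner_exp !hornerXsubC -/f tx rmorphM rmorphXn /= exprD.
set u := (map_poly f U).[t]; set v := (map_poly f V).[t].
have -> : u * (w * f e) ^+ m * (conjc v * (conjc (w * f e) ^+ m * conjc (w * f e) ^+ k))
  = f ((complex.Re w ^+ 2 + complex.Im w ^+ 2) ^+ m * e ^+ (m + m + k)) *
    (conjc w ^+ k * (u * conjc v)).
  have fM (a b : R) : f (a * b) = f a * f b by exact: rmorphM.
  have fX (a : R) i : f (a ^+ i) = f a ^+ i by exact: rmorphXn.
  rewrite fM !fX.
  have -> : f (complex.Re w ^+ 2 + complex.Im w ^+ 2) = w * conjc w.
    by rewrite /f; case: (w) => a b; apply/eqP; rewrite eq_complex /=; apply/andP; split; apply/eqP; ring.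
  have -> : conjc (w * f e) = conjc w * f e by rewrite rmorphM [X in _ * X]conjc_real.
  rewrite !exprMn !exprD; ring.
rewrite Im_real_mul pmulr_rle0 // mulr_gt0 ?exprn_gt0 //.
by rewrite ltr_wpDl ?sqr_ge0 ?exprn_gt0.
Qed.

(* If the pole had order [k >= 2], some [w] in the upper half-plane would satisfy
   [w ^+ k = 'i] and another [w ^+ k = - 'i], and the leading term would change sign. *)
Lemma simple_pole_ge0_residue (R : rcfType) (V Q : {poly R}) (x : R) (m : nat) :
  V.[x] != 0 -> (0 < m)%N ->
  (forall t : R[i], 0 < complex.Im t ->
     complex.Im ((map_poly (real_complex R) Q).[t] *
       conjc (map_poly (real_complex R) (V * ('X - x%:P) ^+ m)).[t]) <= 0) ->
  exists2 q, Q = q * ('X - x%:P) ^+ m.-1 & 0 <= q.[x] * V.[x].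
Proof.
move=> Vx m_gt0 le0.
have [->|Q_neq0] := eqVneq Q 0.
  by exists 0; rewrite ?mul0r // horner0 mul0r.
have [m' [U]] := multiplicity_XsubC Q x; rewrite Q_neq0 /= => Ux QE.
(* If [Q] vanishes at [x] to order at least [m], there is no pole, and the cofactor keeps a factor
   ['X - x%:P]: its value at [x] is 0. *)
have [m_le|m_gt] := leqP m m'.
  exists (U * ('X - x%:P) ^+ (m' - m.-1)); first by rewrite -mulrA -exprD subnK // ; lia.
  rewrite hornerM horner_exp hornerXsubC subrr expr0n.
  by rewrite (_ : (m' - m.-1 == 0)%N = false) ?mulr0 ?mul0r //; apply/negP; lia.
have mE : m = (m' + (m - m').-1.+1)%N by lia.
rewrite QE mE in le0 *; have UV := residue_direction_le0 le0.
have UV_neq0 : U.[x] * V.[x] != 0 by rewrite mulf_neq0.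
(* The pole has order [(m - m').-1.+1]. When it is simple, w = i gives - U(x) V(x) <= 0. *)
case: (m - m').-1 => [|k] in UV le0 mE *.
  exists U; first by rewrite addn1.
  have := UV (Complex 0 1) ltr01; rewrite expr1 /=; lra.
(* Taking w^(k+2) = - i U(x) V(x) builds the sign into the direction: the inequality becomes (U(x)
   V(x))^2 <= 0, whatever the sign of U(x) V(x). *)
have nUV_neq0 : - (U.[x] * V.[x]) != 0 by rewrite oppr_eq0.
have [w [Im_w wE]] := @exp_eq_imaginary R k.+2 _ isT nUV_neq0.
have := UV w Im_w; rewrite -rmorphXn wE /= opprK.
have := sqr_ge0 (U.[x] * V.[x]); have : (U.[x] * V.[x]) ^+ 2 != 0 by rewrite expf_neq0.
by rewrite expr2; case: ltrgtP.
Qed.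

(** * Substitution, the chain rule and Euler's identity for multivariate polynomials *)

Lemma rmorph_mmap (n : nat) (A S T : comNzRingType) (f : A -> S)
    (g : {rmorphism S -> T}) (h : 'I_n -> S) (p : {mpoly A[n]}) :
  g (mmap f h p) = mmap (g \o f) (g \o h) p.
Proof.
rewrite /mmap rmorph_sum; apply: eq_bigr => m _.
rewrite rmorphM rmorph_prod; congr (_ * _).
by apply: eq_bigr => k _; rewrite rmorphXn.
Qed.

Lemma meval_map_mpoly (n : nat) (A S : comNzRingType) (f : {rmorphism A -> S})
    (z : 'I_n -> S) (p : {mpoly A[n]}) :
  (map_mpoly f p).@[z] = mmap f z p.
Proof.
rewrite /map_mpoly (rmorph_mmap _ (meval z)) /mmap.
apply: eq_bigr => m _ /=; rewrite mevalC; congr (_ * _).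
by apply: eq_bigr => k _ /=; rewrite mevalXU.
Qed.

Lemma horner_mmap (n : nat) (A S : comNzRingType) (f : A -> S)
    (L : 'I_n -> {poly S}) (p : {mpoly A[n]}) (t : S) :
  (mmap (polyC \o f) L p).[t] = mmap f (fun k => (L k).[t]) p.
Proof.
rewrite -[LHS]/(horner_eval t _) rmorph_mmap /mmap.
by apply: eq_bigr => m _ /=; rewrite /horner_eval hornerC.
Qed.

(** Chain rule along a curve with constant velocity [v]. It holds on the variables, passes to
    monomials by the Leibniz rule, and then to [p] by linearity. *)
Lemma deriv_mmap (n : nat) (A S : comNzRingType) (f : {rmorphism A -> S})
    (L : 'I_n -> {poly S}) (v : 'I_n -> S) (p : {mpoly A[n]}) :
  (forall k, (L k)^`() = (v k)%:P) ->
  (mmap (polyC \o f) L p)^`() = \sum_k v k *: mmap (polyC \o f) L p^`M(k).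
Proof.
move=> derivL; pose phi := mmap (polyC \o f) L.
pose P (q : {mpoly A[n]}) := (phi q)^`() = \sum_k v k *: phi q^`M(k).
have P1 : P 1.
  rewrite /P /phi rmorph1 -polyC1 derivC big1 // => k _.
  by rewrite -mpolyC1 mderivC rmorph0 scaler0.
have PM q r : P q -> P r -> P (q * r).
  rewrite /P => Pq Pr; rewrite /phi rmorphM derivM -!/phi Pq Pr.
  rewrite mulr_suml mulr_sumr -big_split; apply: eq_bigr => k _ /=.
  by rewrite mderivM /phi rmorphD !rmorphM scalerDr -scalerAl -scalerAr.
have PX i : P 'X_i.
  rewrite /P /phi mmapX mmap1U derivL (bigD1 i) //= big1 => [|k k_neq].
    rewrite mderivX mnm1E eqxx scale1r addr0.
    have -> : (U_(i) - U_(i) = 0)%MM by apply/mnmP => k; rewrite mnmBE subnn mnm0E.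
    by rewrite mpolyX0 rmorph1 alg_polyC.
  rewrite mderivX mnm1E eq_sym (negPf k_neq) scale0r rmorph0.
  exact: scaler0.
rewrite -/(P p); elim/mpolyind: p => [|c m p _ _ IH].
  by rewrite /P /phi raddf0 linear0 big1 // => k _; rewrite linear0 raddf0 scaler0.
have Pm : P 'X_[m].
  rewrite mpolyXE_id; apply: (big_ind P) => // i _.
  by elim: (m i) => [|e IHe]; rewrite ?expr0 // exprS; apply: PM.
rewrite /P /phi mmapD mmapZ /= derivD -/phi IH mul_polyC linearZ /= Pm.
rewrite scaler_sumr -big_split; apply: eq_bigr => k _ /=.
rewrite mderivD mderivZ /phi mmapD mmapZ /= mul_polyC scalerDr.
by congr (_ + _); rewrite !scalerA mulrC.
Qed.

(** The operator on the left scales each monomial ['X_[m]] by [mdeg m]. *)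
Lemma euler_dhomog (n d : nat) (A : comNzRingType) (p : {mpoly A[n]}) :
  p \is d.-homog -> \sum_k 'X_k * p^`M(k) = p *+ d.
Proof.
move=> /dhomogP p_homog.
rewrite [in RHS](mpolyE p) -sumrMnl.
under eq_bigr => k _ do rewrite {1}(mpolyE p) raddf_sum mulr_sumr.
rewrite exchange_big /= big_seq [RHS]big_seq; apply: eq_bigr => m mp.
have <- : mdeg m = d by apply: p_homog.
rewrite mdegE -sumrMnr; apply: eq_bigr => k _.
rewrite /= mderivZ mderivX -!scalerAr -mpolyXD.
(* Subtraction of exponents is truncated, so [m k = 0] is treated apart; there the coefficient [m k]
   kills the term. *)
have [->|mk_gt0] := posnP (m k); first by rewrite scale0r scaler0.
rewrite addmC submK ?lep1mP -?lt0n // -scaler_nat scalerA mulrC -scalerA.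
by rewrite scaler_nat.
Qed.

Lemma dhomog_mderiv (n d : nat) (A : comNzRingType) (p : {mpoly A[n]}) (k : 'I_n) :
  p \is d.-homog -> p^`M(k) \is d.-1.-homog.
Proof.
move=> /dhomogP p_homog; rewrite (mpolyE p) raddf_sum big_seq.
apply: rpred_sum => m mp; rewrite /= mderivZ mderivX rpredZ //.
have [->|mk_gt0] := posnP (m k); first by rewrite scale0r rpred0.
rewrite rpredZ // dhomogX -(p_homog m mp) /=.
rewrite -[m in X in _ == X](@submK _ U_(k)%MM) ?lep1mP -?lt0n //.
by rewrite mdegD mdeg1 addn1.
Qed.

(** * Restriction to the line through [y] in the direction of the all-ones vector *)

(* [idfun] makes the lemmas on [mmap (polyC \o f)] apply. *)
Definition shift_line (n : nat) (A : comNzRingType) (y : 'I_n -> A) (p : {mpoly A[n]}) :=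
  mmap (polyC \o (@idfun A)) (fun k => 'X + (y k)%:P) p.

(** Each monomial of degree [d] restricts to a monic polynomial of degree [d], so the coefficient of
    degree [d] is the sum of the coefficients of [p]. *)
Lemma shift_line_dhomog (n d : nat) (A : comNzRingType) (y : 'I_n -> A) (p : {mpoly A[n]}) :
  p \is d.-homog -> (size (shift_line y p) <= d.+1)%N /\
    (shift_line y p)`_d = p.@[fun=> 1].
Proof.
move=> /dhomogP p_homog.
have mon m : mmap1 (fun k => 'X + (y k)%:P) m \is monic.
  by rewrite /mmap1; apply: monic_prod => i _; apply/monic_exp/monicXaddC.
have size_mon m : size (mmap1 (fun k => 'X + (y k)%:P) m) = (mdeg m).+1.
  rewrite mdegE /mmap1.
  (* Monicity is carried along because [A] may have zero divisors: it makes the sizes of the factors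
     add up exactly. *)
  suff: \prod_(i < n) ('X + (y i)%:P) ^+ m i \is monic /\
     size (\prod_(i < n) ('X + (y i)%:P) ^+ m i) = (\sum_i m i).+1 by case.
  elim/big_rec2: _ => [|i q a _ [mon_q q_a]]; first by rewrite monic1 size_poly1.
  split; first by rewrite monicMl ?monic_exp ?monicXaddC.
  rewrite -addnS -q_a.
  elim: (m i) => [|e IHe]; first by rewrite mul1r.
  rewrite exprS -mulrA size_Mmonic ?monic_neq0 ?monicMl ?monic_exp ?monicXaddC //.
  by rewrite size_XaddC IHe.
split.
  rewrite /shift_line /mmap big_seq.
  apply: (big_ind (fun q : {poly A} => size q <= d.+1)%N) => [|q r qd rd|m mp].
  - by rewrite size_poly0.
  - by rewrite (leq_trans (size_polyD _ _)) // geq_max qd.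
  rewrite mul_polyC (leq_trans (size_scale_leq _ _)) // size_mon.
  by have <- : mdeg m = d by apply: p_homog.
rewrite mevalE /shift_line /mmap coef_sum big_seq [RHS]big_seq.
apply: eq_bigr => m mp; rewrite big1 ?mulr1 => [|k _]; last by rewrite expr1n.
rewrite mul_polyC coefZ; have /monicP := mon m.
rewrite /lead_coef size_mon /= (p_homog m mp : mdeg m = d) => ->.
exact: mulr1.
Qed.

Lemma eq_mmap (n : nat) (A S : nzRingType) (f f' : A -> S) (h h' : 'I_n -> S)
    (p : {mpoly A[n]}) :
  f =1 f' -> h =1 h' -> mmap f h p = mmap f' h' p.
Proof.
move=> ff' hh'; rewrite /mmap; apply: eq_bigr => m _.
by rewrite ff'; congr (_ * _); apply: eq_bigr => k _; rewrite hh'.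
Qed.

(** * Partial fractions with simple poles *)

Lemma prod_XsubC_count (F : idomainType) (s : seq F) (x : F) :
  \prod_(z <- s) ('X - z%:P) =
  (\prod_(z <- s | z != x) ('X - z%:P)) * ('X - x%:P) ^+ count_mem x s.
Proof.
rewrite (bigID (pred1 x)) /= mulrC; congr (_ * _).
elim: s => [|z s IH]; first by rewrite big_nil.
by rewrite big_cons /= IH; case: eqP => [->|//]; rewrite -exprS.
Qed.

(** Powers of distinct linear factors are coprime. Stripping one factor ['X - x%:P] from [E] lowers
    the exponent at [x] by one and, by Gauss's lemma, keeps the others. *)
Lemma dvdp_prod_XsubC_count (F : fieldType) (s : seq F) (E : {poly F}) :
  (forall x, ('X - x%:P) ^+ count_mem x s %| E) -> \prod_(x <- s) ('X - x%:P) %| E.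
Proof.
elim: s E => [|x s IH] E dvdE; first by rewrite big_nil dvd1p.
have /dvdpP[E1 EE1] : 'X - x%:P %| E.
  by apply: dvdp_trans (dvdE x); rewrite /= eqxx exprS dvdp_mulr.
rewrite big_cons mulrC EE1; apply: dvdp_mul => //; apply: IH => z.
have := dvdE z; rewrite EE1 /=; have [->|z_neq] := eqVneq x z.
  by rewrite exprSr dvdp_mul2r // polyXsubC_eq0.
by rewrite add0n Gauss_dvdpl // coprimep_expl // coprimep_XsubC root_XsubC.
Qed.

(** With P the product of the ['X - x%:P] over [s], Q/P has only simple poles, and [a x] is the
    residue at [x] shared equally among the copies of [x] in [s]. Then Q is the sum of the
    [a x *: W x] with W x = P/(X - x) monic: the difference [E] is divisible by P but of smaller
    degree, hence zero. *)
Lemma coef_partial_fractions (F : numFieldType) (s : seq F) (Q : {poly F})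
    (q : F -> {poly F}) :
  (size Q <= size s)%N ->
  (forall x, x \in s -> Q = q x * ('X - x%:P) ^+ (count_mem x s).-1) ->
  Q`_(size s).-1 = \sum_(x <- s) (q x).[x] /
    ((count_mem x s)%:R * (\prod_(z <- s | z != x) ('X - z%:P)).[x]).
Proof.
move=> size_Q QE.
pose V x := \prod_(z <- s | z != x) ('X - z%:P).
have V_neq0 x : (V x).[x] != 0.
  rewrite horner_prod prodf_seq_neq0; apply/allP => z _ /=.
  by apply/implyP => zx; rewrite hornerXsubC subr_eq0 eq_sym.
pose a x := (q x).[x] / ((count_mem x s)%:R * (V x).[x]).
pose W x := \prod_(z <- rem x s) ('X - z%:P).
have size_rem x : x \in s -> size (rem x s) = (size s).-1 by move/size_rem.
have WE x : x \in s -> W x = V x * ('X - x%:P) ^+ (count_mem x s).-1.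
  move=> xs; apply: (@mulIf _ ('X - x%:P)); rewrite ?polyXsubC_eq0 //.
  rewrite -mulrA -exprSr prednK -?has_count ?has_pred1 // -prod_XsubC_count.
  by rewrite (perm_big _ (perm_to_rem xs)) big_cons mulrC.
have W_dvd x z : x \in s -> z != x -> ('X - z%:P) ^+ count_mem z s %| W x.
  move=> xs zx; rewrite /W (prod_XsubC_count _ z) (permP (perm_to_rem xs)) /=.
  by rewrite eq_sym (negPf zx) dvdp_mull.
have W_coef x : x \in s -> (W x)`_(size s).-1 = 1.
  move=> xs; rewrite -(size_rem x xs); have /monicP := monic_prod_XsubC (rem x s) xpredT id.
  by rewrite /lead_coef size_prod_XsubC.
pose E := Q - \sum_(x <- s) a x *: W x.
suff /eqP : E = 0.
  rewrite subr_eq0 => /eqP ->; rewrite coef_sum big_seq [RHS]big_seq.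
  by apply: eq_bigr => x xs; rewrite coefZ W_coef // mulr1.
have size_E : (size E <= size s)%N.
  rewrite (leq_trans (size_polyD _ _)) // geq_max size_Q size_polyN big_seq.
  apply: (big_ind (fun q : {poly F} => size q <= size s)%N) => [|f g fs gs|x xs].
  - by rewrite size_poly0.
  - by rewrite (leq_trans (size_polyD _ _)) // geq_max fs.
  rewrite (leq_trans (size_scale_leq _ _)) // size_prod_XsubC size_rem //.
  by case: (s) xs.
apply/eqP; apply: contraTT size_E => E_neq0; rewrite -ltnNge.
rewrite -(size_prod_XsubC s id); apply: dvdp_leq => //.
apply: dvdp_prod_XsubC_count => x.
have [xs|] := boolP (x \in s); last by move/count_memPn => ->; rewrite expr0 dvd1p.
have m_gt0 : (0 < count_mem x s)%N by rewrite -has_count has_pred1.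
(* Terms at other roots contain the full power of ['X - x%:P]. The copies of [x] contribute its
   multiplicity times [a x *: W x]; after removing the power [(count_mem x s).-1], the choice of
   [a x] makes what is left of [E] vanish at [x]. *)
rewrite /E (bigID (pred1 x)) /= opprD addrA dvdp_add //; last first.
  rewrite dvdpNr big_seq_cond; apply: (big_ind (fun f => _ %| f)).
  - exact: dvdp0.
  - by move=> f g; apply: dvdp_add.
  by move=> z /andP[zs zx]; rewrite -mul_polyC dvdp_mull // W_dvd // eq_sym.
have -> : \sum_(z <- s | z == x) a z *: W z = ((count_mem x s)%:R * a x) *: W x.
  rewrite (eq_bigr (fun=> a x *: W x)) => [|z /eqP -> //].
  by rewrite big_const_seq iter_addr_0 -scalerA scaler_nat.
rewrite (WE x xs) (QE x xs) scalerAl -mulrBl.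
rewrite -{1}(prednK m_gt0) exprS dvdp_mul //.
rewrite dvdp_XsubCl /root hornerD hornerN hornerZ.
have mn : (count_mem x s)%:R != 0 :> F by rewrite pnatr_eq0 -lt0n.
by apply/eqP; rewrite /a; field; rewrite mn V_neq0.
Qed.

(** * Consequences of stability on the line: real roots and the sign of the derivatives *)

Lemma real_roots_split (R : rcfType) (P : {poly R}) :
  (forall t : R[i], 0 < complex.Im t -> (map_poly (real_complex R) P).[t] != 0) ->
  exists s : seq R, P = lead_coef P *: \prod_(x <- s) ('X - x%:P).
Proof.
move=> P_neq0; set f := real_complex R in P_neq0 *.
have [rs PE] := closed_field_poly_normal (map_poly f P).
have P_neq0' : map_poly f P != 0.
  have := P_neq0 (Complex 0 1) ltr01.
  by apply: contra_neq => ->; rewrite horner0.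
have Im_rs z : z \in rs -> f (complex.Re z) = z.
  rewrite -root_prod_XsubC -(rootZ _ _ (_ : lead_coef (map_poly f P) != 0)) ?lead_coef_eq0 //.
  rewrite -PE => Pz.
  (* The coefficients are real, so a root in the lower half-plane would have its conjugate as a root
     in the upper one. *)
  have Pz' : root (map_poly f P) (conjc z).
    by rewrite -complex_root_conj -map_poly_comp (eq_map_poly (g := f)) // => c /=; exact: conjc_real.
  have Im0 : complex.Im z = 0.
    apply/eqP; have [Im_lt0|Im_gt0|//] := ltrgtP (complex.Im z) 0.
      have : 0 < complex.Im (conjc z).
        by case: (z) Im_lt0 => u v /=; rewrite oppr_gt0.
      by move=> /P_neq0; rewrite (rootP Pz') eqxx.
    by have := P_neq0 z Im_gt0; rewrite (rootP Pz) eqxx.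
  by case: (z) Im0 => u v /= ->.
exists (map (@complex.Re R) rs).
apply: (map_inj_poly (f := f)) => //; first exact: complexI.
rewrite PE linearZ /= lead_coef_map; congr (_ *: _).
rewrite map_prod_XsubC big_map big_seq [RHS]big_seq; apply: eq_bigr => z zs.
by congr ('X - _%:P); rewrite -[LHS](Im_rs z zs).
Qed.

Lemma horner_map_shift_line (R : rcfType) (n : nat) (y : 'I_n -> R) (q : {mpoly R[n]})
    (t : R[i]) :
  (map_poly (real_complex R) (shift_line y q)).[t] =
  mmap (real_complex R) (fun k => real_complex R (y k) + t) q.
Proof.
rewrite rmorph_mmap -[LHS]/(horner_eval t _) rmorph_mmap.
apply: eq_mmap => [c|k] /=; rewrite /horner_eval ?map_polyC ?hornerC //.
by rewrite rmorphD /= map_polyX map_polyC !hornerE addrC.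
Qed.

Lemma shift_line_neq0 (R : realType) (n : nat) (p : {mpoly R[n]}) (y : 'I_n -> R) :
  real_stable p -> forall t : R[i], 0 < complex.Im t ->
  (map_poly (real_complex R) (shift_line y p)).[t] != 0.
Proof.
move=> p_stable t Im_t; rewrite horner_map_shift_line -meval_map_mpoly.
by apply: p_stable => k; case: t Im_t => u v /=; rewrite add0r.
Qed.

Lemma Im_mderiv_mul_conj_le0 (R : realType) (n : nat) (p : {mpoly R[n]})
    (y : 'I_n -> R) (j : 'I_n) :
  real_stable p -> forall t : R[i], 0 < complex.Im t ->
  complex.Im ((map_poly (real_complex R) (shift_line y p^`M(j))).[t] *
    conjc (map_poly (real_complex R) (shift_line y p)).[t]) <= 0.
Proof.
move=> p_stable t Im_t; pose f := real_complex R.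
pose L k : {poly R[i]} := (k == j)%:R *: 'X + (f (y k) + t)%:P.
pose F := mmap (polyC \o f) L p.
have F0 q : (mmap (polyC \o f) L q).[0] = (map_poly f (shift_line y q)).[t].
  rewrite horner_mmap horner_map_shift_line; apply: eq_mmap => // k.
  by rewrite /L hornerD hornerZ hornerX hornerC mulr0 add0r.
have <- : F^`().[0] = (map_poly f (shift_line y p^`M(j))).[t].
  rewrite (@deriv_mmap _ _ _ (real_complex R) L (fun k => (k == j)%:R)); last first.
    move=> k; rewrite derivD derivZ derivX derivC addr0.
    by rewrite -mul_polyC mulr1.
  rewrite (bigD1 j) //= big1 => [|k /negPf ->]; last by rewrite scale0r.
  by rewrite eqxx scale1r addr0 F0.
(* Real [s] is allowed too: [t] already gives every coordinate a positive imaginary part, and moving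
   the coordinate [j] by [s] does not lower it. *)
rewrite -F0; apply: Im_deriv_mul_conj_le0 => s Im_s.
rewrite horner_mmap -meval_map_mpoly; apply: p_stable => k.
have ImD (u v : R[i]) : complex.Im (u + v) = complex.Im u + complex.Im v.
  by case: u v => [? ?] [].
rewrite /L hornerD hornerZ hornerX hornerC !ImD /= add0r.
by case: (k == j); rewrite ?mul1r ?mul0r ltr_wpDl.
Qed.

(** * Products of linear forms with unit row sums *)

Lemma meval_prod_eq1 (A : comNzRingType) (n : nat) (I : Type) (r : seq I)
    (l : I -> {mpoly A[n]}) (x : 'I_n -> A) (k : 'I_n) :
  (forall i, (l i).@[x] = 1) ->
  (\prod_(i <- r) l i).@[x] = 1 /\
  ((\prod_(i <- r) l i)^`M(k)).@[x] = \sum_(i <- r) ((l i)^`M(k)).@[x].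
Proof.
move=> l1; elim: r => [|i r [IH1 IHk]].
  by rewrite !big_nil meval1 -mpolyC1 mderivC meval0.
(* Every factor is 1 at [x], so the cofactors in the Leibniz rule drop out. *)
rewrite !big_cons mderivM mevalD !mevalM IH1 IHk !l1 !mulr1.
by rewrite mul1r.
Qed.

Lemma row_stochastic_prod_linear_forms (R : realType) (d n : nat) (a : 'M[R]_(d, n)) :
  (forall i, \sum_j a i j = 1) ->
  (prod_linear_forms a).@[@all_ones R n] = 1 /\
  forall k, ((prod_linear_forms a)^`M(k)).@[@all_ones R n] = \sum_i a i k.
Proof.
move=> a1.
have l1 i : (\sum_(j < n) a i j *: 'X_j).@[@all_ones R n] = 1.
  rewrite raddf_sum -[RHS](a1 i); apply: eq_bigr => j _.
  by rewrite /= mevalZ mevalXU /all_ones mulr1.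
split=> [|k]; rewrite /prod_linear_forms.
  by rewrite rmorph_prod big1 // => i _; exact: l1.
have [_ ->] := meval_prod_eq1 (index_enum _) k l1.
apply: eq_bigr => i _; rewrite [mderiv _ _]raddf_sum raddf_sum (bigD1 k) //= big1 => [|j jk].
  rewrite mderivZ mevalZ mderivX mnm1E eqxx scale1r addr0.
  have -> : (U_(k) - U_(k) = 0)%MM by apply/mnmP => j; rewrite mnmBE subnn mnm0E.
  by rewrite mpolyX0 meval1 mulr1.
by rewrite mderivZ mderivX mnm1E (negPf jk) scale0r scaler0 meval0.
Qed.

(** * Construction of the matrix from the residues *)

Theorem theorem2p4 (R : realType) (n d : nat) (hn : (1 <= n)%N) (hd : (1 <= d)%N)
    (p : {mpoly R[n]}) (alpha : 'rV[R]_n)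
    (p_stable : real_stable p) (p_homog : p \is d.-homog)
    (p_ge0 : nonneg_coeffs p)
    (p1 : p.@[@all_ones R n] = 1) (grad_p1 : gradient p (@all_ones R n) = alpha)
    (y : 'I_n -> R) (y_gt0 : forall j, 0 < y j) :
  exists a : 'M[R]_(d, n),
    let f := prod_linear_forms a in
    [/\ forall i j, 0 <= a i j,
        f.@[@all_ones R n] = 1,
        gradient f (@all_ones R n) = alpha
      & p.@[y] = f.@[y]].
Proof.
pose P := shift_line y p; pose Q j := shift_line y p^`M(j).
have [size_P Pd] : (size P <= d.+1)%N /\ P`_d = 1.
  by have [sP cP] := shift_line_dhomog y p_homog; split; rewrite // cP.
have size_Q j : (size (Q j) <= d)%N /\ (Q j)`_d.-1 = alpha 0 j.
  have [sQ cQ] := shift_line_dhomog y (dhomog_mderiv j p_homog).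
  by rewrite prednK // in sQ; split; rewrite // cQ -grad_p1 mxE.
have {size_P} size_P : size P = d.+1.
  apply/eqP; rewrite eqn_leq size_P ltnNge; apply/negP => size_P'.
  by have /eqP := Pd; rewrite nth_default // eq_sym oner_eq0.
have [s PE] := real_roots_split (shift_line_neq0 y p_stable).
rewrite -/P /lead_coef size_P Pd scale1r in PE.
have size_s : size s = d by have := size_P; rewrite PE size_prod_XsubC => -[].
pose m x := count_mem x s.
pose V x := \prod_(z <- s | z != x) ('X - z%:P).
have V_neq0 x : (V x).[x] != 0.
  rewrite horner_prod prodf_seq_neq0; apply/allP => z _ /=.
  by apply/implyP => zx; rewrite hornerXsubC subr_eq0 eq_sym.
have m_gt0 x : x \in s -> (0 < m x)%N by move=> xs; rewrite -has_count has_pred1.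
(* At a root [x] of P the division is exact because the poles are simple; the quotient names the
   cofactor for all [x] and [j] at once. *)
pose q x j := Q j %/ ('X - x%:P) ^+ (m x).-1.
have qP x j : x \in s ->
    Q j = q x j * ('X - x%:P) ^+ (m x).-1 /\ 0 <= (q x j).[x] * (V x).[x].
  move=> xs; have := Im_mderiv_mul_conj_le0 y j p_stable.
  rewrite -/P PE (prod_XsubC_count s x) -/(V x) -/(m x) -/(Q j).
  move=> /(simple_pole_ge0_residue (V_neq0 x) (m_gt0 x xs)) [q' QE q'_ge0].
  suff -> : q x j = q' by [].
  by rewrite /q QE mulpK // expf_neq0 // polyXsubC_eq0.
have exp_neq0 x : ('X - x%:P) ^+ (m x).-1 != 0 :> {poly R}.
  by rewrite expf_neq0 // polyXsubC_eq0.
have P_loc x : x \in s -> P = V x * ('X - x%:P) * ('X - x%:P) ^+ (m x).-1.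
  by move=> xs; rewrite -mulrA -exprS prednK ?m_gt0 // PE (prod_XsubC_count s x).
have sum_q x : x \in s -> \sum_j (q x j).[x] = (m x)%:R * (V x).[x].
  move=> xs; rewrite -horner_sum.
  (* With P = V (X - x)^m, cancelling (X - x)^(m-1) in P' leaves V' (X - x) + m V, whose value at x
     is m V(x). *)
  have : P^`() = \sum_j Q j.
    rewrite /P /shift_line (@deriv_mmap _ _ _ idfun _ (fun=> 1)).
      by apply: eq_bigr => j _; rewrite scale1r.
    by move=> k; rewrite derivD derivX derivC addr0.
  rewrite PE (prod_XsubC_count s x) -/(V x) -/(m x) derivM deriv_exp derivXsubC mul1r.
  rewrite (eq_bigr (fun j => q x j * ('X - x%:P) ^+ (m x).-1)); last first.
    by move=> j _; case: (qP x j xs).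
  rewrite -mulr_suml -{1}(prednK (m_gt0 x xs)) exprS mulrA mulrnAr -mulrnAl -mulrDl.
  move=> /(mulIf (exp_neq0 x)) <-.
  by rewrite hornerD hornerMn hornerM hornerXsubC subrr mulr0 add0r mulr_natl.
have sum_yq x : x \in s -> \sum_j y j * (q x j).[x] = - x * \sum_j (q x j).[x].
  (* Euler's identity on the line. After cancelling (X - x)^(m-1) the right side still vanishes at
     x, so the sum of the (x + y_j) q_j(x) is 0. *)
  move=> xs; have : \sum_j ('X + (y j)%:P) * Q j = P *+ d.
    rewrite /P /shift_line -rmorphMn -(euler_dhomog p_homog) rmorph_sum.
    by apply: eq_bigr => j _; rewrite rmorphM /= mmapX mmap1U.
  rewrite (P_loc x xs) -mulrnAl.
  rewrite (eq_bigr (fun j => ('X + (y j)%:P) * q x j * ('X - x%:P) ^+ (m x).-1)); last first.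
    by move=> j _; case: (qP x j xs) => {1}-> _; rewrite mulrA.
  rewrite -mulr_suml => /(mulIf (exp_neq0 x)) /(congr1 (horner_eval x)).
  rewrite /horner_eval hornerMn hornerM hornerXsubC subrr mulr0 mul0rn horner_sum.
  move=> /eqP; under eq_bigr => j _ do rewrite hornerM hornerD hornerX hornerC mulrDl.
  by rewrite big_split -mulr_sumr /= addrC addr_eq0 mulNr => /eqP.
(* Rows follow the roots listed with multiplicity, so a multiple root gives equal rows; dividing by
   [m] makes each row sum to 1. *)
pose a := \matrix_(i < d, j < n)
  ((q s`_i j).[s`_i] / ((m s`_i)%:R * (V s`_i).[s`_i])).
have s_i (i : 'I_d) : s`_i \in s by rewrite mem_nth // size_s.
have mV_neq0 (i : 'I_d) : (m s`_i)%:R * (V s`_i).[s`_i] != 0.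
  by rewrite mulf_neq0 // pnatr_eq0 -lt0n m_gt0.
have row_a i : \sum_j a i j = 1.
  under eq_bigr => j _ do rewrite mxE.
  by rewrite -mulr_suml sum_q // divff.
have row_ay i : \sum_j a i j * y j = - s`_i.
  under eq_bigr => j _ do rewrite mxE mulrAC [_.[_] * _]mulrC.
  by rewrite -mulr_suml sum_yq // sum_q // mulfK.
have col_a j : \sum_i a i j = alpha 0 j.
  have [sQ <-] := size_Q j; rewrite -[in RHS]size_s.
  rewrite (@coef_partial_fractions _ s (Q j) (fun x => q x j)) ?size_s //; last first.
    by move=> x xs; case: (qP x j xs).
  by rewrite (big_nth 0) big_mkord size_s; apply: eq_bigr => i _; rewrite mxE.
have [f1 grad_f] := row_stochastic_prod_linear_forms row_a.
exists a; split=> //.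
- move=> i j; rewrite mxE; have [_ qV] := qP _ j (s_i i).
  (* [V] may be negative at the root; multiplying above and below by it leaves a square in the
     denominator and a numerator of known sign. *)
  have -> : (q s`_i j).[s`_i] / ((m s`_i)%:R * (V s`_i).[s`_i]) =
    (q s`_i j).[s`_i] * (V s`_i).[s`_i] / ((m s`_i)%:R * (V s`_i).[s`_i] ^+ 2).
    by have := mV_neq0 i; rewrite mulf_eq0 negb_or => /andP[? ?]; field; apply/andP.
  by rewrite divr_ge0 // mulr_ge0 // sqr_ge0.
- by apply/rowP => j; rewrite mxE grad_f.
have -> : p.@[y] = P.[0].
  by rewrite horner_mmap; apply: eq_mmap => // k; rewrite !hornerE.
rewrite PE horner_prod rmorph_prod (big_nth 0) big_mkord size_s; apply: eq_bigr => i _.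
rewrite hornerXsubC sub0r -row_ay raddf_sum; apply: eq_bigr => j _.
by rewrite /= mevalZ mevalXU.
Qed.
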